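(* Let $\mathcal{G}_b=(\mathcal{A}_b\cup\mathcal{B}_b,\mathcal{E}_b)$ be a bipartite graph with edge weights $w:\mathcal{E}_b\to\mathbb{R}$, and let $\mathcal{M}$ be a maximum cardinality matching of $\mathcal{G}_b$ that is a solution to the Sequential Bottleneck Assignment Problem (SeqBAP) for $\mathcal{G}_b$, with sequentially selected edges $e_k=\{i_k,j_k\}$ and associated graphs $\mathcal{G}^k$, $k\in\{1,\dots,n\}$, as in the definition of the SeqBAP. Then $P(\mathcal{G}^k,e_k)>0$ for all $k\in\{1,\dots,n\}$ (all sequentially selected edges have positive price of absence in their respective graphs $\mathcal{G}^k$) if and only if $\mathcal{M}$ is the unique solution to the SeqBAP for $\mathcal{G}_b$.
   Context: Setting: $\mathcal{G}_b=(\mathcal{V}_b,\mathcal{E}_b)$ is a finite undirected bipartite graph with $\mathcal{V}_b=\mathcal{A}_b\cup\mathcal{B}_b$, $\mathcal{A}_b\cap\mathcal{B}_b=\emptyset$, $\emptyset\neq\mathcal{E}_b\subseteq\{\{i,j\}\mid i\in\mathcal{A}_b,j\in\mathcal{B}_b\}$, and weights $w:\mathcal{E}_b\to\mathbb{R}$. A matching is a set of edges no two of which share a vertex; an MCM is a matching of maximum cardinality. $\mathcal{C}(\mathcal{G})$ is the set of MCMs of $\mathcal{G}$, $\mathcal{F}(\mathcal{G})$ is the cardinality of an MCM of $\mathcal{G}$, and $n=\mathcal{F}(\mathcal{G}_b)$. Bottleneck weight: $\mathcal{W}(\mathcal{G})=\min_{\mathcal{M}\in\mathcal{C}(\mathcal{G})}\max_{e\in\mathcal{M}}w(e)$.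 Price of absence: for a graph $\mathcal{G}=(\mathcal{V},\mathcal{E})$ and $e\in\mathcal{E}$, $P(\mathcal{G},e)=\mathcal{W}((\mathcal{V},\mathcal{E}\setminus\{e\}))-\mathcal{W}((\mathcal{V},\mathcal{E}))$ if $\mathcal{F}((\mathcal{V},\mathcal{E}))=\mathcal{F}((\mathcal{V},\mathcal{E}\setminus\{e\}))$, and $P(\mathcal{G},e)=+\infty$ otherwise (the value $+\infty$ counts as positive). For a set of edges $\mathcal{E}$, $\mathcal{L}(\mathcal{E})=\arg\max_{e\in\mathcal{E}}w(e)$ (the set of all maximisers). SeqBAP: an MCM $\mathcal{M}\in\mathcal{C}(\mathcal{G}_b)$ is a solution if its edges can be labelled $\{i_1,j_1\},\dots,\{i_n,j_n\}$ (with $i_k\in\mathcal{A}_b$, $j_k\in\mathcal{B}_b$; these are the sequentially selected edges) and there are matchings $\mathcal{M}^1,\dots,\mathcal{M}^n$ such that, with $\mathcal{A}^1=\mathcal{A}_b$, $\mathcal{B}^1=\mathcal{B}_b$, $\mathcal{A}^k=\mathcal{A}^{k-1}\setminus\{i_{k-1}\}$, $\mathcal{B}^k=\mathcal{B}^{k-1}\setminus\{j_{k-1}\}$ for $2\le k\le n$, $\mathcal{E}^k=\{\{i,j\}\in\mathcal{E}_b\mid i\in\mathcal{A}^k,j\in\mathcal{B}^k\}$ and $\mathcal{G}^k=(\mathcal{A}^k\cup\mathcal{B}^k,\mathcal{E}^k)$, for every $k\in\{1,\dots,n\}$: $\mathcal{M}^k\in\arg\min_{\mathcal{M}'\in\mathcal{C}(\mathcal{G}^k)}\max_{e\in\mathcal{M}'}w(e)$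 and $\{i_k,j_k\}\in\arg\max_{e\in\mathcal{L}(\mathcal{M}^k)}P(\mathcal{G}^k,e)$. Uniqueness of a solution refers to the MCM as a set of edges, irrespective of the labelling and of the matchings $\mathcal{M}^k$. *)

(* Defs.v *)
(* MathComp, with the extended reals of MathComp-Analysis for the price of
   absence. *)
From HB Require Import structures.
From mathcomp Require Import all_boot all_order all_algebra.
From mathcomp Require Import reals constructive_ereal.

Set Implicit Arguments.
Unset Strict Implicit.
Unset Printing Implicit Defensive.

Import Order.TTheory GRing.Theory Num.Theory.

Section Graph.
Variable T : finType.

(* An edge {i, j} is the set [set i; j] : {set T}. The vertex set may be a
   proper subset of T. That edges join vertices of the graph is not built in:
   for the graphs considered below it follows from Eb \subset between Ab Bb. *)
Record graph := Graph { vertices : {set T}; edges : {set {set T}} }.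

Definition del_edge (G : graph) (e : {set T}) : graph :=
  Graph (vertices G) (edges G :\ e).

Definition between (A B : {set T}) : {set {set T}} :=
  [set [set i; j] | i in A, j in B].

Definition matchings (G : graph) : {set {set {set T}}} :=
  [set M : {set {set T}} | (M \subset edges G) && trivIset M].

Definition mcm_card (G : graph) : nat := \max_(M in matchings G) #|M|.

Definition mcms (G : graph) : {set {set {set T}}} :=
  [set M in matchings G | #|M| == mcm_card G].

End Graph.

Section Bottleneck.
Local Open Scope ereal_scope.
Variables (R : realType) (T : finType) (w : {set T} -> R).

(* Equals -oo on the empty set of edges. *)
Definition max_weight (M : {set {set T}}) : \bar R :=
  \big[maxe/-oo]_(e in M) (w e)%:E.

(* A minimum over a nonempty set, since every graph has an MCM. It is finite
   as soon as the graph has a nonempty matching. *)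
Definition bottleneck_weight (G : graph T) : \bar R :=
  \big[mine/+oo]_(M in mcms G) max_weight M.

Definition bottleneck_mcms (G : graph T) : {set {set {set T}}} :=
  [set M in mcms G | [forall N in mcms G, max_weight M <= max_weight N]].

(* If e is an edge of G (so that [set e] is a matching) and the first case
   applies, both bottleneck weights are finite and the difference is the usual
   one. *)
Definition price (G : graph T) (e : {set T}) : \bar R :=
  if mcm_card G == mcm_card (del_edge G e)
  then bottleneck_weight (del_edge G e) - bottleneck_weight G
  else +oo.

Definition heaviest (M : {set {set T}}) : {set {set T}} :=
  [set e in M | [forall f in M, (w f <= w e)%R]].

Definition max_price_edges (G : graph T) (M : {set {set T}}) :
    {set {set T}} :=
  [set e in heaviest M | [forall f in heaviest M, price G f <= price G e]].

End Bottleneck.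

Section SeqBAP.
Variables (R : realType) (T : finType).
Variables (Ab Bb : {set T}) (Eb : {set {set T}}) (w : {set T} -> R).

Definition base_graph : graph T := Graph (Ab :|: Bb) Eb.

(* Removes v 0, ..., v k.-1 from S: the sets A^(k+1), B^(k+1), as steps are
   numbered from 0. *)
Fixpoint remaining (S : {set T}) (v : nat -> T) (k : nat) : {set T} :=
  if k is k'.+1 then remaining S v k' :\ v k' else S.

Definition step_graph (i j : nat -> T) (k : nat) : graph T :=
  let A := remaining Ab i k in
  let B := remaining Bb j k in
  Graph (A :|: B) [set e in Eb | e \in between A B].

Definition selected (i j : nat -> T) (k : nat) : {set T} := [set i k; j k].

(* Only the values at k < mcm_card base_graph of i, j and Ms matter. The
   selected edges are pairwise distinct because they enumerate M, which has
   mcm_card base_graph elements. *)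
Definition seqbap_run (M : {set {set T}}) (i j : nat -> T)
    (Ms : nat -> {set {set T}}) : Prop :=
  let n := mcm_card base_graph in
  [/\ M \in mcms base_graph,
      forall k, k < n -> i k \in Ab /\ j k \in Bb,
      M = [set selected i j k | k : 'I_n] &
      forall k, k < n ->
        Ms k \in bottleneck_mcms w (step_graph i j k) /\
        selected i j k \in max_price_edges w (step_graph i j k) (Ms k)].

Definition seqbap_solution (M : {set {set T}}) : Prop :=
  exists (i j : nat -> T) (Ms : nat -> {set {set T}}), seqbap_run M i j Ms.

End SeqBAP.

(* Main.v *)
(* Write S for the set of edges selected so far and call an edge critical if it
   lies in every bottleneck MCM of the residual graph; this amounts to positive
   price. If all edges of a run with result M are critical when selected, then
   for any S contained in M obtained in another run, the first edge of the given
   run outside S is still critical. Hence the next edge of the other run, being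
   of maximal price, is critical too, and it belongs to M because M \ S is a
   bottleneck MCM of the residual graph.
   Conversely, if a selected edge e is not critical, some bottleneck MCM avoids
   it, and the run can be continued from that step without ever taking e. *)
Require Import Defs.
From mathcomp Require Import all_boot all_order all_algebra.
From mathcomp Require Import reals constructive_ereal.

Set Implicit Arguments.
Unset Strict Implicit.
Unset Printing Implicit Defensive.

Import Order.TTheory.

(** * Residual graphs and their maximum cardinality matchings *)

Section Residual.
Variable T : finType.
Implicit Types (G : graph T) (P S M N K : {set {set T}}).

(** Depends on the set [S] alone and not on the order of selection, which makes different runs
    comparable. The vertices stay, since matchings only see edges. *)
Definition residual G S : graph T :=
  Graph (vertices G) [set e in edges G | [disjoint e & cover S]].

Lemma residualP G S e :
  reflect (e \in edges G /\ forall f, f \in S -> [disjoint e & f])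
          (e \in edges (residual G S)).
Proof.
rewrite inE; apply: (iffP andP) => -[eG eS]; split=> //.
  by move=> f fS; move/bigcup_disjointP: eS; apply.
exact/bigcup_disjointP.
Qed.

Lemma edges_residual_sub G S : edges (residual G S) \subset edges G.
Proof. by apply/subsetP => e /residualP[]. Qed.

Lemma residualD G P S :
  P \subset S -> residual (residual G P) (S :\: P) = residual G S.
Proof.
move=> PS; congr Graph; apply/setP => e; apply/residualP/residualP.
  case=> /residualP[eG eP] eSP; split=> // f fS.
  by have [/eP//|fP] := boolP (f \in P); apply: eSP; rewrite inE fP.
case=> eG eS; split=> [|f]; last by rewrite inE => /andP[_ /eS].
by apply/residualP; split=> // f /(subsetP PS)/eS.
Qed.

(** A common edge would be disjoint from itself, hence empty; this is why [set0] must not be an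
    edge. *)
Lemma residual_disjoint G S N :
  set0 \notin edges G -> N \subset edges (residual G S) -> [disjoint S & N].
Proof.
move=> G0 /subsetP NG; rewrite -setI_eq0; apply/set0Pn => -[e].
rewrite inE => /andP[eS /NG/residualP[eG /(_ e eS)]].
by rewrite -setI_eq0 setIid => /eqP e0; rewrite -e0 eG in G0.
Qed.

Lemma mem_matchings G M :
  (M \in matchings G) = (M \subset edges G) && trivIset M.
Proof. by rewrite inE. Qed.

Lemma matching_residualU G S N :
  S \in matchings G -> N \in matchings (residual G S) ->
  S :|: N \in matchings G.
Proof.
rewrite !mem_matchings => /andP[SG tS] /andP[NG tN].
rewrite subUset SG (subset_trans NG (edges_residual_sub G S)) /=.
apply: (trivIsetU tS tN); apply/bigcup_disjointP => f /(subsetP NG).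
by rewrite inE disjoint_sym => /andP[].
Qed.

Lemma matching_residualD G S K :
  K \in matchings G -> S \subset K -> K :\: S \in matchings (residual G S).
Proof.
rewrite !mem_matchings => /andP[KG tK] SK; apply/andP; split; last first.
  exact: trivIsetS (subsetDl _ _) tK.
apply/subsetP => e; rewrite !inE => /andP[eS eK].
rewrite (subsetP KG) //=; apply/bigcup_disjointP => f fS.
apply: (trivIsetP tK) => //; first exact: (subsetP SK).
by apply: contraNneq eS => ->.
Qed.

Lemma mem_mcms G M :
  (M \in mcms G) = (M \in matchings G) && (#|M| == mcm_card G).
Proof. by rewrite [LHS]in_set. Qed.

Lemma mcmP G M :
  reflect (M \in matchings G /\
           forall N, N \in matchings G -> #|N| <= #|M|) (M \in mcms G).
Proof.
rewrite mem_mcms; apply: (iffP andP) => -[MG].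
  by move=> /eqP cM; split=> // N NG; rewrite cM; apply: leq_bigmax_cond.
move=> maxM; split=> //; rewrite eqn_leq; apply/andP; split.
  exact: (@leq_bigmax_cond _ (mem (matchings G)) (fun M => #|M|)).
by apply/bigmax_leqP.
Qed.

Lemma mcm_matching G M : M \in mcms G -> M \in matchings G.
Proof. by case/mcmP. Qed.

Lemma mcm_sub G M : M \in mcms G -> M \subset edges G.
Proof. by move/mcm_matching; rewrite mem_matchings => /andP[]. Qed.

Lemma card_mcm G M : M \in mcms G -> #|M| = mcm_card G.
Proof. by rewrite mem_mcms => /andP[_ /eqP]. Qed.

Lemma mcm_exists G : exists M, M \in mcms G.
Proof.
have m0 : set0 \in matchings G.
  by rewrite mem_matchings sub0set /trivIset big_set0 /cover big_set0 cards0.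
have [|M MG cM] :=
  @eq_bigmax_cond _ (mem (matchings G)) (fun M : {set {set T}} => #|M|).
  by apply/card_gt0P; exists set0.
by exists M; rewrite mem_mcms /mcm_card cM MG eqxx.
Qed.

Lemma mcm_neq0 G M e : e \in edges G -> M \in mcms G -> M != set0.
Proof.
move=> eG /mcmP[_ /(_ [set e])]; rewrite mem_matchings sub1set eG.
rewrite /trivIset /cover !big_set1 eqxx cards1 card_gt0.
by apply.
Qed.

Lemma subset_mcm_matching G S K :
  K \in mcms G -> S \subset K -> S \in matchings G.
Proof.
move=> /mcm_matching; rewrite !mem_matchings => /andP[KG tK] SK.
by rewrite (subset_trans SK KG) (trivIsetS SK tK).
Qed.

Lemma card_matching_residualU G S N :
  set0 \notin edges G -> N \in matchings (residual G S) ->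
  #|S :|: N| = #|S| + #|N|.
Proof.
move=> G0; rewrite mem_matchings => /andP[NG _]; apply/eqP.
by rewrite (leq_card_setU S N) (residual_disjoint G0 NG).
Qed.

(** For a matching [N] of the residual graph, [S :|: N] is a matching of [G], so maximality of [K]
    bounds [#|N|]. *)
Lemma mcm_residualD G S K :
  set0 \notin edges G -> K \in mcms G -> S \subset K ->
  K :\: S \in mcms (residual G S).
Proof.
move=> G0 Kmcm SK; have [KG Kmax] := mcmP _ _ Kmcm; apply/mcmP; split.
  exact: matching_residualD.
move=> N NG.
have := Kmax _ (matching_residualU (subset_mcm_matching Kmcm SK) NG).
rewrite (card_matching_residualU G0) // -(cardsID S K) (setIidPr SK).
by rewrite leq_add2l.
Qed.

Lemma mcm_residualU G S K N :
  set0 \notin edges G -> K \in mcms G -> S \subset K ->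
  N \in mcms (residual G S) -> S :|: N \in mcms G.
Proof.
move=> G0 Kmcm SK Nmcm; have NG := mcm_matching Nmcm.
have cK := card_mcm (mcm_residualD G0 Kmcm SK).
rewrite mem_mcms matching_residualU ?(subset_mcm_matching Kmcm) //=.
rewrite (card_matching_residualU G0) // -(card_mcm Kmcm) (card_mcm Nmcm) -cK.
by rewrite -(cardsID S K) (setIidPr SK).
Qed.

End Residual.

(** * Bottleneck matchings and the sign of the price of absence *)

Section Price.
Variables (R : realType) (T : finType) (w : {set T} -> R).
Implicit Types (G : graph T) (P S M N K : {set {set T}}) (e f g : {set T}).

(** Edgewise form that allows bottleneck MCMs to be handled through real weights; the default [-oo]
    makes it cover empty [M] and [N]. *)
Lemma max_weight_leP M N :
  reflect (forall f, f \in M -> exists2 g, g \in N & (w f <= w g)%R)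
          (max_weight w M <= max_weight w N)%E.
Proof.
apply: (iffP idP) => [leMN f fM|leMN].
  have : ((w f)%:E <= max_weight w N)%E.
    by apply: le_trans leMN; apply: (le_bigmax_cond _ (fun f => (w f)%:E)).
  have [N0|[g0 g0N]] := set_0Vmem N.
    by rewrite N0 /max_weight big_set0 leeNy_eq.
  have [g gN] := @eq_bigmax _ _ _ (-oo)%E g0 (fun f => f \in N)
    (fun f => (w f)%:E) g0N (fun f _ => leNye _).
  rewrite /max_weight => ->.
  by rewrite lee_fin; exists g.
apply/bigmax_leP; split=> [|f /leMN[g gN le_fg]]; first exact: leNye.
by apply: (@bigmax_sup _ _ _ _ g) => //; rewrite lee_fin.
Qed.

Lemma mem_bottleneck_mcms G K :
  (K \in bottleneck_mcms w G) =
  (K \in mcms G) && [forall N in mcms G, max_weight w K <= max_weight w N]%E.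
Proof. by rewrite [LHS]in_set. Qed.

Lemma bottleneck_mcmP G K :
  reflect (K \in mcms G /\ forall N, N \in mcms G ->
             forall f, f \in K -> exists2 g, g \in N & (w f <= w g)%R)
          (K \in bottleneck_mcms w G).
Proof.
rewrite mem_bottleneck_mcms; apply: (iffP andP) => -[KG].
  by move=> /forall_inP minK; split=> // N /minK/max_weight_leP.
by move=> minK; split=> //; apply/forall_inP => N /minK/max_weight_leP.
Qed.

Lemma bottleneck_mcm_mcm G K : K \in bottleneck_mcms w G -> K \in mcms G.
Proof. by case/bottleneck_mcmP. Qed.

Lemma bottleneck_mcm_exists G :
  exists2 K, K \in bottleneck_mcms w G & bottleneck_weight w G = max_weight w K.
Proof.
have [K0 K0G] := mcm_exists G.
have [K KG WK] := @eq_bigmin _ _ _ (+oo)%E K0 (fun N => N \in mcms G)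
  (max_weight w) K0G (fun N _ => leey _).
exists K => //; rewrite mem_bottleneck_mcms KG; apply/forall_inP => N NG.
by rewrite -WK; apply: (@bigmin_le_cond _ _ _ _ N).
Qed.

Lemma bottleneck_weightE G K :
  K \in bottleneck_mcms w G -> bottleneck_weight w G = max_weight w K.
Proof.
have [K' + ->] := bottleneck_mcm_exists G.
rewrite !mem_bottleneck_mcms.
move=> /andP[KG /forall_inP minK] /andP[KG' /forall_inP minK'].
by apply/eqP; rewrite eq_le minK ?minK'.
Qed.

Lemma heaviestP M e :
  reflect (e \in M /\ forall f, f \in M -> (w f <= w e)%R) (e \in heaviest w M).
Proof.
rewrite [X in reflect _ X]in_set.
by apply: (iffP andP) => -[eM /forall_inP].
Qed.

Lemma max_price_edgesP G M e :
  reflect (e \in heaviest w M /\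
           forall f, f \in heaviest w M -> (price w G f <= price w G e)%E)
          (e \in max_price_edges w G M).
Proof.
rewrite [X in reflect _ X]in_set.
by apply: (iffP andP) => -[eM /forall_inP].
Qed.

Lemma max_price_edge_exists G M :
  M != set0 -> exists e, e \in max_price_edges w G M.
Proof.
case/set0Pn=> e0 e0M.
have [e eM maxe] := @arg_maxP _ _ _ e0 (fun f => f \in M) w e0M.
have eh : e \in heaviest w M by apply/heaviestP.
have [f fM maxf] :=
  @arg_maxP _ _ _ e (fun f => f \in heaviest w M) (price w G) eh.
by exists f; apply/max_price_edgesP.
Qed.

Lemma mcms_del_edge G e M :
  mcm_card G = mcm_card (del_edge G e) ->
  (M \in mcms (del_edge G e)) = (M \in mcms G) && (e \notin M).
Proof.
move=> cG; rewrite !mem_mcms !mem_matchings -cG subsetD1.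
by case: (e \notin M); rewrite ?andbT ?andbF.
Qed.

(* An edge has positive price exactly when deleting it destroys every
   bottleneck MCM. *)
Lemma price_gt0P G e :
  e \in edges G ->
  reflect (forall N, N \in bottleneck_mcms w G -> e \in N) (0 < price w G e)%E.
Proof.
move=> eG; apply: (iffP idP) => [|crit].
  rewrite /price; case: eqP => [cG pos|cG _] N Nb;
    have NG := bottleneck_mcm_mcm Nb.
    move: pos; rewrite sube_gt0 ltNge; apply: contraNT => eN.
    rewrite (bottleneck_weightE Nb); apply: bigmin_le_cond.
    by rewrite /= mcms_del_edge ?NG.
  (* Infinite price: an [N] avoiding [e] would survive the deletion and keep the MCM cardinality
     unchanged. *)
  apply/negPn/negP => eN; apply: cG; apply/eqP; rewrite eqn_leq; apply/andP.
  split.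
    rewrite -(card_mcm NG).
    apply: (@leq_bigmax_cond _ (mem (matchings _)) (fun M => #|M|)) => /=.
    move/mcm_matching: NG.
    by rewrite !mem_matchings subsetD1 eN andbT.
  have [K KG] := mcm_exists (del_edge G e).
  rewrite -(card_mcm KG).
  apply: (@leq_bigmax_cond _ (mem (matchings _)) (fun M => #|M|)) => /=.
  move/mcm_matching: KG.
  by rewrite !mem_matchings subsetD1 => /andP[/andP[-> _] ->].
rewrite /price; case: eqP => [cG|_]; last exact: ltry.
rewrite sube_gt0 ltNge; apply/negP.
(* Were the price nonpositive, this [N], which avoids [e], would be a bottleneck MCM of [G] too. *)
have [N Nb ->] := bottleneck_mcm_exists (del_edge G e).
have := bottleneck_mcm_mcm Nb; rewrite mcms_del_edge // => /andP[NG eN] le_N.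
have /negP[] := eN; apply: crit.
rewrite mem_bottleneck_mcms NG; apply/forall_inP => M MG.
apply: le_trans le_N _; exact: bigmin_le_cond.
Qed.

End Price.

(** * Sets of initial values of a sequence *)

Section Prefix.
Variable X : finType.
Implicit Types (e : nat -> X) (k l n : nat) (f : X).

Definition prefix_set e k : {set X} :=
  [set e l | l : 'I_k].

Lemma prefix_setP e k f :
  reflect (exists2 l, l < k & f = e l) (f \in prefix_set e k).
Proof.
apply: (iffP imsetP) => [[l _ ->]|[l lk ->]]; first by exists l.
by exists (Ordinal lk).
Qed.

Lemma prefix_set0 e : prefix_set e 0 = set0.
Proof. by apply/setP => f; rewrite inE; apply/prefix_setP => -[]. Qed.

Lemma prefix_setS e k : prefix_set e k.+1 = e k |: prefix_set e k.
Proof.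
apply/setP => f; rewrite !inE; apply/prefix_setP/orP => [[l]|].
  rewrite ltnS leq_eqVlt => /orP[/eqP-> ->|lk ->]; first by left.
  by right; apply/prefix_setP; exists l.
case=> [/eqP->|/prefix_setP[l lk ->]]; first by exists k.
by exists l => //; apply: leqW.
Qed.

Lemma eq_prefix_set e e' k :
  (forall l, l < k -> e l = e' l) -> prefix_set e k = prefix_set e' k.
Proof. by move=> ee'; apply: eq_imset => l; apply: ee'. Qed.

End Prefix.

(** * Greedy selection, independently of labellings *)

Section Greedy.
Variables (R : realType) (T : finType) (w : {set T} -> R).
Variables (G : graph T) (G0 : set0 \notin edges G).
Implicit Types (P S M N K : {set {set T}}) (e f g : {set T}).

(* The sets of edges selected by the first steps of a run of SeqBAP. *)
Inductive greedy : {set {set T}} -> Prop :=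
| greedy_set0 : greedy set0
| greedy_setU1 S K e :
    greedy S -> K \in bottleneck_mcms w (residual G S) ->
    e \in max_price_edges w (residual G S) K -> greedy (e |: S).

Lemma max_price_edge_mem H K e : e \in max_price_edges w H K -> e \in K.
Proof. by case/max_price_edgesP => /heaviestP[]. Qed.

Lemma mcm_residual_notin S K e :
  K \in mcms (residual G S) -> e \in K -> e \notin S.
Proof.
move=> /mcm_sub KG eK; apply/negP => eS.
by have /disjointFr/(_ eS) := residual_disjoint G0 KG; rewrite eK.
Qed.

(** Once [S] extends to an MCM of [G], so does [S] with any MCM of its residual graph added; that
    union contains the next selected edge. *)
Lemma greedy_sub_mcm S : greedy S -> exists2 K, K \in mcms G & S \subset K.
Proof.
elim=> [|{}S K e _ [L LG SL] /bottleneck_mcm_mcm KS /max_price_edge_mem eK].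
  by have [K KG] := mcm_exists G; exists K; rewrite ?sub0set.
exists (S :|: K); first exact: mcm_residualU LG SL KS.
by rewrite subUset subsetUl andbT sub1set inE eK orbT.
Qed.

Lemma set0_notin_residual S : set0 \notin edges (residual G S).
Proof. by apply: contra G0; apply: (subsetP (edges_residual_sub G S)). Qed.

Lemma mcm_residualU1 S N f :
  N \in mcms (residual G S) -> f \in N -> N :\ f \in mcms (residual G (f |: S)).
Proof.
move=> NS fN; have fS := mcm_residual_notin NS fN.
rewrite -(@residualD _ G S (f |: S)) ?subsetUr //.
have -> : (f |: S) :\: S = [set f].
  by rewrite setDUl setDv setU0; apply/setDidPl; rewrite disjoints1.
by apply: mcm_residualD NS _; rewrite ?set0_notin_residual ?sub1set.
Qed.

(** The weight of [e] is the bottleneck weight of [H], because [e] is heaviest in a bottleneck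
    MCM. *)
Lemma mcm_le_heaviest H K e N :
  K \in bottleneck_mcms w H -> e \in heaviest w K -> N \in mcms H ->
  (forall f, f \in N -> (w f <= w e)%R) -> N \in bottleneck_mcms w H.
Proof.
move=> /bottleneck_mcmP[_ minK] /heaviestP[eK _] NH le_e.
apply/bottleneck_mcmP; split=> // L LH f /le_e le_fe.
by have [g gL le_eg] := minK _ LH _ eK; exists g => //; apply: le_trans le_eg.
Qed.

(* As long as a bottleneck MCM avoiding e remains, continue with it; once the
   bottleneck weight drops below w e, no step can select e. *)
Lemma greedy_avoid e S N :
  greedy S -> e \notin S -> N \in bottleneck_mcms w (residual G S) ->
  e \notin N -> (forall f, f \in N -> (w f <= w e)%R) ->
  exists M, [/\ greedy M, M \in mcms G & e \notin M].
Proof.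
move cN: #|N| => n; elim: n S N cN => [|n IHn] S N cN gS eS Nb eN le_e.
  (* Here [N] is empty, so [S] is already an MCM of [G]. *)
  have [K KG SK] := greedy_sub_mcm gS.
  have := mcm_residualU G0 KG SK (bottleneck_mcm_mcm Nb).
  by rewrite (cards0_eq cN) setU0; exists S.
have NS := bottleneck_mcm_mcm Nb.
have [|f fmax] := @max_price_edge_exists _ _ w (residual G S) N.
  by rewrite -card_gt0 cN.
have fN := max_price_edge_mem fmax.
have gfS := greedy_setU1 gS Nb fmax.
have efS : e \notin f |: S.
  by rewrite !inE negb_or eS andbT; apply: contraNneq eN => ->.
have NfS := mcm_residualU1 NS fN.
have cNf : #|N :\ f| = n by move: cN; rewrite (cardsD1 f) fN => -[].
have [K Kb _] := bottleneck_mcm_exists w (residual G (f |: S)).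
have /bottleneck_mcmP[KfS minK] := Kb.
have le_eNf h : h \in N :\ f -> (w h <= w e)%R by rewrite inE => /andP[_ /le_e].
have le_eK h : h \in K -> (w h <= w e)%R.
  by move=> /(minK _ NfS)[g gN le_hg]; apply: le_trans le_hg (le_eNf _ gN).
(* If [K] avoids [e], continue with [K]. Otherwise the bottleneck weight is still [w e], so [N :\ f]
   is itself a bottleneck MCM, and it avoids [e]. *)
have [eK|eK] := boolP (e \in K); last first.
  by apply: (IHn (f |: S) K) => //; rewrite (card_mcm KfS) -(card_mcm NfS).
apply: (IHn (f |: S) (N :\ f)) => //; last by rewrite inE (negPf eN) andbF.
by apply: mcm_le_heaviest Kb _ NfS le_eNf; apply/heaviestP.
Qed.

(** * Rigidity of a run whose selected edges all have positive price *)

Section PositivePrices.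
Variables (n : nat) (e : nat -> {set T}) (Ms : nat -> {set {set T}}).
Hypothesis MG : prefix_set e n \in mcms G.
Hypothesis Ms_bot : forall k, k < n ->
  Ms k \in bottleneck_mcms w (residual G (prefix_set e k)).
Hypothesis e_heavy : forall k, k < n -> e k \in heaviest w (Ms k).
Hypothesis e_pos : forall k, k < n ->
  (0 < price w (residual G (prefix_set e k)) (e k))%E.

(** Removing the selected edge from [Ms l] leaves an MCM of the next residual graph, so bottleneck
    weights, which are the weights of the selected edges, cannot rise. *)
Lemma selected_weight_noninc k l :
  k <= l -> l < n -> (w (e l) <= w (e k))%R.
Proof.
elim: l => [|l IHl]; first by rewrite leqn0 => /eqP->.
rewrite leq_eqVlt => /orP[/eqP->//|kl] ln; have ln' := ltnW ln.
apply: le_trans (IHl kl ln').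
have /heaviestP[el maxl] := e_heavy ln'.
have /heaviestP[el1 _] := e_heavy ln.
have := mcm_residualU1 (bottleneck_mcm_mcm (Ms_bot ln')) el.
rewrite -prefix_setS => Nl.
have /bottleneck_mcmP[_ minl] := Ms_bot ln.
have [g] := minl _ Nl _ el1.
by rewrite inE => /andP[_ /maxl le_g] le_lg; apply: le_trans le_g.
Qed.

(* The first selected edge e m outside S lies in every bottleneck MCM N of the
   residual graph of S: N together with the edges of S outside the prefix is a
   bottleneck MCM of the residual graph of the prefix. *)
Lemma greedy_sub S : greedy S -> S \subset prefix_set e n.
Proof.
elim=> [|{}S K f gS SM Kb fmax]; first exact: sub0set.
rewrite subUset SM andbT sub1set.
have fK := max_price_edge_mem fmax.
have KS := bottleneck_mcm_mcm Kb.
have MS := mcm_residualD G0 MG SM.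
(* The rest of the given result is an MCM of a graph that has the edge [f], so it is not empty. *)
have : exists m, (m < n) && (e m \notin S).
  have /set0Pn[g] : prefix_set e n :\: S != set0.
    by apply: mcm_neq0 MS; apply: (subsetP (mcm_sub KS)) fK.
  rewrite inE => /andP[gS' /prefix_setP[m mn gE]]; exists m.
  by rewrite mn -gE.
case/ex_minnP => m /andP[mn emS] min_m.
have PS : prefix_set e m \subset S.
  apply/subsetP => g /prefix_setP[l lm ->]; apply: contraTT lm => elS.
  rewrite -leqNgt; have [ln|nl] := ltnP l n; first by rewrite min_m // ln.
  exact: leq_trans (ltnW mn) nl.
set P := prefix_set e m in PS *; have PM := subset_trans PS SM.
have Pb : Ms m \in bottleneck_mcms w (residual G P) := Ms_bot mn.
have crit : forall N, N \in bottleneck_mcms w (residual G P) -> e m \in N.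
  apply/price_gt0P; last exact: e_pos.
  apply: (subsetP (mcm_sub (bottleneck_mcm_mcm Pb))).
  by case/heaviestP: (e_heavy mn).
have le_MP g : g \in prefix_set e n -> g \notin P -> (w g <= w (e m))%R.
  case/prefix_setP=> l ln -> elP; apply: selected_weight_noninc => //.
  by rewrite leqNgt; apply: contraNN elP => lm; apply/prefix_setP; exists l.
(* Stated with a weight bound instead of the bottleneck property, so that it can first serve to show
   that the rest of the given result is a bottleneck MCM. *)
have crit_S N : N \in mcms (residual G S) ->
    (forall g, g \in N -> (w g <= w (e m))%R) -> e m \in N.
  move=> NS le_N.
  have : (S :\: P) :|: N \in mcms (residual G P).
    apply: (@mcm_residualU _ _ _ (prefix_set e n :\: P)).
    - exact: set0_notin_residual.
    - exact: mcm_residualD.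
    - exact: setSD.
    - by rewrite residualD.
  move=> /(mcm_le_heaviest Pb (e_heavy mn)) SPN.
  have /crit : (S :\: P) :|: N \in bottleneck_mcms w (residual G P).
    apply: SPN => g; rewrite !inE => /orP[/andP[gP gS']|/le_N//].
    by apply: le_MP gP; apply: (subsetP SM).
  by rewrite !inE (negPf emS) andbF.
have le_MS g : g \in prefix_set e n :\: S -> (w g <= w (e m))%R.
  rewrite inE => /andP[gS' gM]; apply: le_MP gM _.
  by apply: contraNN gS'; apply: (subsetP PS).
have MSb : prefix_set e n :\: S \in bottleneck_mcms w (residual G S).
  apply/bottleneck_mcmP; split=> // N NS g /le_MS le_g.
  (* Every MCM [N] has an edge at least as heavy as [e m]: [e m] itself by [crit_S], or an edge
     exceeding its weight. *)
  have [/forall_inP le_N|] := boolP [forall h in N, (w h <= w (e m))%R].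
    by exists (e m) => //; apply: crit_S.
  rewrite negb_forall_in => /exists_inP[h hN]; rewrite -ltNge => lt_h.
  by exists h => //; apply: le_trans le_g (ltW lt_h).
have le_bot N g : N \in bottleneck_mcms w (residual G S) -> g \in N ->
    (w g <= w (e m))%R.
  move=> /bottleneck_mcmP[_ minN] /(minN _ MS)[h hM le_gh].
  exact: le_trans le_gh (le_MS _ hM).
have crit_bot N : N \in bottleneck_mcms w (residual G S) -> e m \in N.
  move=> Nb; apply: crit_S (bottleneck_mcm_mcm Nb) _ => g.
  exact: le_bot.
have em_pos : (0 < price w (residual G S) (e m))%E.
  apply/price_gt0P; last exact: crit_bot.
  by apply: (subsetP (mcm_sub KS)); apply: crit_bot.
have em_heavy : e m \in heaviest w K.
  by apply/heaviestP; split=> [|g]; [exact: crit_bot|exact: le_bot].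
(* The edge [f] competes with [e m] among the heaviest edges of [K], so its price is positive as
   well. *)
have [_ /(_ _ em_heavy) le_price] := max_price_edgesP _ _ _ _ fmax.
have /price_gt0P : (0 < price w (residual G S) f)%E.
  exact: lt_le_trans em_pos le_price.
move=> /(_ (subsetP (mcm_sub KS) _ fK) _ MSb).
by rewrite inE => /andP[].
Qed.

End PositivePrices.
End Greedy.

(** * From labelled runs on bipartite graphs to greedy sets *)

Section Bipartite.
Variables (R : realType) (T : finType) (w : {set T} -> R).
Variables (Ab Bb : {set T}) (Eb : {set {set T}}).
Hypotheses (disjAB : [disjoint Ab & Bb]) (Eb_neq0 : Eb != set0).
Hypothesis Eb_bip : Eb \subset between Ab Bb.
Let G := base_graph Ab Bb Eb.
Implicit Types (i j v : nat -> T) (Ms : nat -> {set {set T}}) (k l : nat).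

Lemma set0_notin_base : set0 \notin edges G.
Proof.
apply/negP => /(subsetP Eb_bip)/imset2P[a b _ _ /setP/(_ a)].
by rewrite !inE eqxx.
Qed.

Lemma remainingP (S : {set T}) v k x :
  reflect (x \in S /\ forall l, l < k -> x != v l) (x \in remaining S v k).
Proof.
elim: k => [|k IHk] /=; first by apply: (iffP idP) => [|[]].
rewrite !inE; apply: (iffP andP) => [[xk /IHk[xS xl]]|[xS xl]].
  split=> // l; rewrite ltnS leq_eqVlt => /orP[/eqP->//|]; exact: xl.
split; first exact: xl.
by apply/IHk; split=> // l lk; apply/xl/leqW.
Qed.

(** Endpoints on opposite sides never coincide. Hence deleting the two ends of an edge, each from
    its own side, removes exactly the edges that meet it. *)
Lemma disjoint_pairs a b c d :
  a \in Ab -> b \in Bb -> c \in Ab -> d \in Bb ->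
  [disjoint [set a; b] & [set c; d]] = (a != c) && (b != d).
Proof.
move=> aA bB cA dB.
have neqAB x y : x \in Ab -> y \in Bb -> (x == y) = false.
  by move=> xA yB; apply: contraTF yB => /eqP<-; rewrite (disjointFr disjAB xA).
rewrite -setI_eq0 setIUl setU_eq0 !setI_eq0 !disjoints1 !inE.
rewrite (neqAB a d) // [b == c]eq_sym (neqAB c b) //.
by rewrite orbF.
Qed.

(** [step_graph] drops vertices and [residual] keeps them, so the two are only identified through
    their edges. *)
Lemma eq_bottleneck_mcms (H H' : graph T) :
  edges H = edges H' -> bottleneck_mcms w H = bottleneck_mcms w H'.
Proof. by case: H => V E; case: H' => V' E' /= ->. Qed.

Lemma eq_price (H H' : graph T) : edges H = edges H' -> price w H = price w H'.
Proof. by case: H => V E; case: H' => V' E' /= ->. Qed.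

Lemma eq_max_price_edges (H H' : graph T) :
  edges H = edges H' -> max_price_edges w H = max_price_edges w H'.
Proof. by case: H => V E; case: H' => V' E' /= ->. Qed.

Lemma edges_step_graph i j k :
  (forall l, l < k -> i l \in Ab /\ j l \in Bb) ->
  edges (step_graph Ab Bb Eb i j k) =
  edges (residual G (prefix_set (selected i j) k)).
Proof.
move=> ijAB; apply/setP => e; rewrite [LHS]in_set.
apply/andP/residualP => /= -[eE].
  case/imset2P=> a b /remainingP[aA ai] /remainingP[bB bj] eab.
  split=> // f /prefix_setP[l lk ->]; have [iA jB] := ijAB l lk.
  by rewrite eab disjoint_pairs // ai ?bj.
move=> e_disj; split=> //.
case/imset2P: (subsetP Eb_bip _ eE) => a b aA bB eab.
have neq l : l < k -> (a != i l) && (b != j l).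
  move=> lk; have [iA jB] := ijAB l lk.
  rewrite -disjoint_pairs // -eab; apply: e_disj.
  by apply/prefix_setP; exists l.
by apply/imset2P; exists a b => //; apply/remainingP; split=> // l /neq/andP[].
Qed.

Definition residual_steps n i j Ms : Prop :=
  forall k, k < n ->
    [/\ i k \in Ab /\ j k \in Bb,
        Ms k \in bottleneck_mcms w (residual G (prefix_set (selected i j) k)) &
        selected i j k \in
          max_price_edges w (residual G (prefix_set (selected i j) k)) (Ms k)].

Lemma seqbap_runE M i j Ms :
  seqbap_run Ab Bb Eb w M i j Ms <->
  [/\ M \in mcms G, M = prefix_set (selected i j) (mcm_card G) &
      residual_steps (mcm_card G) i j Ms].
Proof.
split=> [[MG ijAB ME steps]|[MG ME steps]].
  split=> // k kn; have [Mk ek] := steps k kn; split; first exact: ijAB.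
    rewrite -(@eq_bottleneck_mcms _ _ (edges_step_graph _)) // => l lk.
    exact: ijAB (ltn_trans lk kn).
  rewrite -(@eq_max_price_edges _ _ (edges_step_graph _)) // => l lk.
  exact: ijAB (ltn_trans lk kn).
have ijAB k : k < mcm_card G -> i k \in Ab /\ j k \in Bb by case/steps.
split=> // k kn; have [_ Mk ek] := steps k kn.
have eqE : edges (step_graph Ab Bb Eb i j k) =
    edges (residual G (prefix_set (selected i j) k)).
  by apply: edges_step_graph => l lk; apply: ijAB (ltn_trans lk kn).
by rewrite (eq_bottleneck_mcms eqE) (eq_max_price_edges eqE).
Qed.

Lemma greedy_prefix_set n i j Ms k :
  residual_steps n i j Ms -> k <= n ->
  greedy w G (prefix_set (selected i j) k).
Proof.
move=> steps; elim: k => [|k IHk] kn; first by rewrite prefix_set0; constructor.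
have [_ Mk ek] := steps k kn.
by rewrite prefix_setS; apply: greedy_setU1 (IHk (ltnW kn)) Mk ek.
Qed.

(** Each selected edge is new, so [#|S|] counts the steps; bipartiteness supplies the two labels of
    each edge. *)
Lemma greedy_residual_steps S :
  greedy w G S -> exists i j Ms,
    S = prefix_set (selected i j) #|S| /\ residual_steps #|S| i j Ms.
Proof.
elim=> [|{}S K e _ [i [j [Ms]]] + Kb emax].
  (* Even the empty run needs total sequences, hence some element of [T]. *)
  have /set0Pn[e /(subsetP Eb_bip)/imset2P[a b _ _ _]] := Eb_neq0.
  exists (fun=> a), (fun=> a), (fun=> set0).
  by rewrite cards0 prefix_set0.
have eK := max_price_edge_mem emax.
have KS := bottleneck_mcm_mcm Kb.
have -> : #|e |: S| = #|S|.+1.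
  by rewrite cardsU1 (mcm_residual_notin set0_notin_base KS eK).
move: #|S| => m [SE steps].
have /residualP[/= eE _] := subsetP (mcm_sub KS) _ eK.
case/imset2P: (subsetP Eb_bip _ eE) => a b aA bB eab.
(* Only index [m] is overwritten, so the first [m] steps remain valid. *)
pose i' l := if l == m then a else i l.
pose j' l := if l == m then b else j l.
pose Ms' l := if l == m then K else Ms l.
have sel l : l < m -> selected i' j' l = selected i j l.
  by move=> lm; rewrite /selected /i' /j' ltn_eqF.
have selm : selected i' j' m = e by rewrite /selected /i' /j' eqxx.
have pre k : k <= m ->
    prefix_set (selected i' j') k = prefix_set (selected i j) k.
  by move=> km; apply: eq_prefix_set => l lk; apply/sel/(leq_trans lk).
exists i', j', Ms'; split; first by rewrite prefix_setS selm pre // -SE.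
move=> k; rewrite ltnS leq_eqVlt => /orP[/eqP->|km].
  by rewrite selm pre // -SE /i' /j' /Ms' eqxx.
by rewrite sel // pre 1?ltnW // /i' /j' /Ms' ltn_eqF //; apply: steps.
Qed.

(** Eliminates labels and auxiliary matchings, so that uniqueness concerns edge sets only. *)
Lemma seqbap_solutionP M :
  seqbap_solution Ab Bb Eb w M <-> M \in mcms G /\ greedy w G M.
Proof.
split=> [[i [j [Ms]]] /seqbap_runE[MG ME steps]|[MG gM]].
  by split=> //; rewrite ME; apply: greedy_prefix_set steps _.
have [i [j [Ms [ME steps]]]] := greedy_residual_steps gM.
by exists i, j, Ms; apply/seqbap_runE; rewrite -(card_mcm MG).
Qed.

End Bipartite.

Theorem proposition5 (R : realType) (T : finType) (Ab Bb : {set T})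
    (Eb : {set {set T}}) (w : {set T} -> R)
    (disjAB : [disjoint Ab & Bb])
    (Eb_neq0 : Eb != set0)
    (Eb_bip : Eb \subset between Ab Bb)
    (M : {set {set T}}) (i j : nat -> T) (Ms : nat -> {set {set T}})
    (run : seqbap_run Ab Bb Eb w M i j Ms) :
  (forall k : nat, k < mcm_card (base_graph Ab Bb Eb) ->
     (0 < price w (step_graph Ab Bb Eb i j k) (selected i j k))%E)
  <-> unique (seqbap_solution Ab Bb Eb w) M.
Proof.
have Msol : seqbap_solution Ab Bb Eb w M by exists i, j, Ms.
have G0 := set0_notin_base Eb_bip.
have /(seqbap_runE w disjAB Eb_bip)[MG ME steps] := run.
have Ms_bot k kn : Ms k \in _ := let: And3 _ Mk _ := steps k kn in Mk.
have e_max k kn : selected i j k \in _ := let: And3 _ _ ek := steps k kn in ek.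
have e_heavy k kn : selected i j k \in heaviest w (Ms k) :=
  proj1 (max_price_edgesP _ _ _ _ (e_max k kn)).
have priceE k : k < mcm_card (base_graph Ab Bb Eb) ->
    price w (step_graph Ab Bb Eb i j k) =
    price w (residual (base_graph Ab Bb Eb) (prefix_set (selected i j) k)).
  move=> kn; apply/eq_price/edges_step_graph => // l lk.
  by case: (steps l (ltn_trans lk kn)).
split=> [pos|[_ uniqM] k kn].
  split=> // M' /(seqbap_solutionP w disjAB Eb_neq0 Eb_bip)[MG' gM'].
  (* Both solutions have the same cardinality, so the inclusion of [M'] in [M] suffices. *)
  apply/esym/eqP; rewrite eqEcard (card_mcm MG) (card_mcm MG') leqnn andbT ME.
  apply: (greedy_sub G0 _ Ms_bot e_heavy _ gM'); first by rewrite -ME.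
  by move=> k kn; rewrite -priceE // pos.
have Mk := bottleneck_mcm_mcm (Ms_bot k kn).
have /heaviestP[ek max_ek] := e_heavy k kn.
rewrite priceE //; apply/price_gt0P; first exact: (subsetP (mcm_sub Mk)).
move=> N Nb; apply: contraT => eN.
have eP := mcm_residual_notin G0 Mk ek.
have gP := greedy_prefix_set steps (ltnW kn).
(* Branching off at step [k] gives a solution without the selected edge, hence different from
   [M]. *)
have [f fN|M' [gM' MG' eM']] := greedy_avoid G0 gP eP Nb eN.
  have /bottleneck_mcmP[_ minN] := Nb.
  by have [g /max_ek le_g le_fg] := minN _ Mk _ fN; apply: le_trans le_g.
have /uniqM MM' : seqbap_solution Ab Bb Eb w M' by apply/seqbap_solutionP.
by case/negP: eM'; rewrite -MM' ME; apply/prefix_setP; exists k.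
Qed.
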